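(* Let $s,t,v\ge0$ be integers and $\omega=s+t+v$. Any storage-balanced schedule, on the $p$-processor parallel machine, of any execution DAG of the symmetry preserving algorithm $\Phi^{(s,t,v)}$ for symmetric tensor contractions of dimension $n$ has horizontal communication cost $W_\Phi(n,s,t,v,p)$ satisfying: 1. $W_\Phi(n,s,t,v,p)=\Omega\big((n^\omega/p)^{\kappa/\omega}\big)$ with $\kappa=\max(s+v,v+t,s+t)$, when $s,t,v\ge1$; 2. $W_\Phi(n,s,t,v,p)=\Omega\big((n^\omega/p)^{\max(s,t,v)/\omega}\big)$, when exactly one of $s,t,v$ is zero.
   Context: Asymptotics. $n$ and $p$ are asymptotic parameters and $s,t,v$ are constants: $W=\Omega(f(n,p))$ means that there are constants $\gamma>0,n_0,p_0$ depending only on $s,t,v$ such that $W\ge\gamma f(n,p)$ for every schedule of the stated type, for all $n\ge n_0$, $p\ge p_0$ satisfying the divisibility assumption below. Bilinear algorithm. A bilinear algorithm is a triple of real matrices $(F^{(A)},F^{(B)},F^{(C)})$ with the same number of columns. On input vectors $a,b$ it computes $c=F^{(C)}\big[((F^{(A)})^{\mathsf T}a)\odot((F^{(B)})^{\mathsf T}b)\big]$, $\odot$ being the entrywise product. Its rank is the number of columns. Tuples. Let $I_n^d=\{(i_1,\dots,i_d)\in\{1,\dots,n\}^d: i_1\le\dots\le i_d\}$, so $|I_n^d|=\binom{n+d-1}{d}$. For a tuple $k$ of length $q+r$, $\bar\chi^q_r(k)$ is the set of all distinct pairs of tuples of lengths $q$ and $r$ obtained by choosing $q$ positions of $k$, listing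 the entries at these positions in order, and listing the remaining entries in order. For a tuple $k$ of length $d$, $\rho(k)=d!/\prod_i m_i!$ where $m_i$ are the multiplicities of the distinct values of $k$. Symmetry preserving algorithm $\Phi^{(s,t,v)}$. It is an algorithm for the symmetrized contraction over $v$ indices of a symmetric tensor $A$ of order $s+v$ with a symmetric tensor $B$ of order $v+t$ into a symmetric tensor of order $s+t$, all dimensions $n$ (only its leading-order part is considered; lower-order correction terms computable with $O(n^{\omega-1})$ products are excluded). As a bilinear algorithm: rows of $F^{(A)},F^{(B)},F^{(C)}$ are indexed by $I_n^{s+v},I_n^{v+t},I_n^{s+t}$ respectively, columns by $i\in I_n^\omega$. The only nonzeros are: $F^{(A)}_{j,i}=t!/\rho(a')$ if $(j,a')\in\bar\chi^{s+v}_t(i)$ for some tuple $a'$ of length $t$; $F^{(B)}_{l,i}=s!/\rho(b')$ if $(l,b')\in\bar\chi^{v+t}_s(i)$ for some tuple $b'$ of length $s$; $F^{(C)}_{h,i}=s!\,t!\,\rho(c')$ if $(h,c')\in\bar\chi^{s+t}_v(i)$ for some tuple $c'$ of length $v$. Execution DAG. An execution DAG of a bilinear algorithm is a directed acyclic graph $G=(V,E)$ in which each vertex has in-degree $0$ (an input value, i.e. an entry of $a$ or $b$) or in-degree $2$ (the result of a weighted addition or of a multiplication of its two predecessors). $V$ is a disjoint union $V^{(A)}\cup V^{(B)}\cup V^{(C)}$: vertices of $V^{(A)}$ (resp. $V^{(B)}$) are linear combinations of entries of $a$ (resp. $b$), vertices of $V^{(C)}$ are the computed products and linear combinations of products; $V^{(M)}\subseteq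 V^{(C)}$ is the set of computed products, one for each column. The outputs (entries of $c$) are vertices of $V^{(C)}$. Edges go within $V^{(A)}$, within $V^{(B)}$ (these compute, by additions, the operands of the products), from $V^{(A)}$ to $V^{(M)}$ and from $V^{(B)}$ to $V^{(M)}$ (each product has exactly one operand from each), and from $V^{(C)}$ to $V^{(C)}\setminus V^{(M)}$ (summations computing the outputs as prescribed by $F^{(C)}$). Parallel machine with $p$ processors. The processors have a fully connected network and exchange elements (vertex values) by point-to-point messages. A parallel schedule of an execution DAG assigns each non-input vertex to exactly one processor, which computes it (no recomputation); operands must be present on that processor, either because it initially owned them, computed them, or received them. Each input element is on exactly one processor at the start. The horizontal communication cost $W$ is the largest, over processors, total number of elements sent and received by that processor. A schedule is storage-balanced if at the start each processor owns exactly a $1/p$ fraction of the entries of each of $a$ and $b$, and at the end each processor owns exactly a $1/p$ fraction of the entries of $c$, each output entry being on a unique processor. It is assumed that $p$ divides the number of entries of each of $a,b,c$ and the number of products (columns). *)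

(* Defs.v *)
From HB Require Import structures.
From mathcomp Require Import all_boot all_order all_algebra.
From mathcomp Require Import reals exp.

Set Implicit Arguments.
Unset Strict Implicit.
Unset Printing Implicit Defensive.

Import Order.TTheory GRing.Theory Num.Theory.
Local Open Scope ring_scope.

Record bilinear_algorithm (R : realType) := BilinearAlgorithm {
  dimA : nat;
  dimB : nat;
  dimC : nat;
  brank : nat;
  matA : 'M[R]_(dimA, brank);
  matB : 'M[R]_(dimB, brank);
  matC : 'M[R]_(dimC, brank)
}.

Definition bilinear_products (R : realType) (L : bilinear_algorithm R)
    (a : 'cV[R]_(dimA L)) (b : 'cV[R]_(dimB L)) : 'cV[R]_(brank L) :=
  map2_mx *%R ((matA L)^T *m a) ((matB L)^T *m b).

Definition bilinear_apply (R : realType) (L : bilinear_algorithm R)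
    (a : 'cV[R]_(dimA L)) (b : 'cV[R]_(dimB L)) : 'cV[R]_(dimC L) :=
  matC L *m bilinear_products a b.

Definition incr_tuple (n d : nat) :=
  {k : d.-tuple 'I_n | sorted leq (map val k)}.

(* The mask [m] selects the positions of the first component; since the two
   components are tuples of sizes [q] and [r], exactly [q] positions are
   selected.  Only used with [size k = q + r]. *)
Definition chibar (T : finType) (q r : nat) (k : seq T) :
    {set q.-tuple T * r.-tuple T} :=
  [set x : q.-tuple T * r.-tuple T | [exists m : (size k).-tuple bool,
     (x.1 == mask m k :> seq T) && (x.2 == mask [seq ~~ b | b <- m] k :> seq T)]].

Definition rho (R : realType) (T : eqType) (k : seq T) : R :=
  (size k)`!%:R / (\prod_(x <- undup k) (count_mem x k)`!)%:R.

(* [split_coef q r f j i] is [f j'] if [(j, j')] is in [chibar q r i] for some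
   [j'], and [0] if there is no such [j'].  As [i] is nondecreasing, there is
   at most one such [j']. *)
Definition split_coef (R : realType) (n q r d : nat)
    (f : r.-tuple 'I_n -> R) (j : incr_tuple n q) (i : incr_tuple n d) : R :=
  if [pick j' : r.-tuple 'I_n | (val j, j') \in chibar q r (val i)] is Some j'
  then f j' else 0.

Definition sym_preserving (R : realType) (s t v n : nat) :
    bilinear_algorithm R :=
  @BilinearAlgorithm R
    #|{: incr_tuple n (s + v)}| #|{: incr_tuple n (v + t)}|
    #|{: incr_tuple n (s + t)}| #|{: incr_tuple n (s + t + v)}|
    (\matrix_(j, i) split_coef (fun a' : t.-tuple 'I_n => t`!%:R / rho R a')
                      (enum_val j) (enum_val i))
    (\matrix_(l, i) split_coef (fun b' : s.-tuple 'I_n => s`!%:R / rho R b')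
                      (enum_val l) (enum_val i))
    (\matrix_(h, i) split_coef
                      (fun c' : v.-tuple 'I_n => s`!%:R * t`!%:R * rho R c')
                      (enum_val h) (enum_val i)).

Definition preds (V : finType) (E : rel V) (x : V) : {set V} :=
  [set y | E y x].

(* [coefA x] (resp. [coefB x]) is the vector of coefficients of the value of a
   vertex of [VA] (resp. [VB]) as a linear combination of the entries of [a]
   (resp. [b]); [coefC x] is that of a vertex of [VC] as a formal linear
   combination of the products.  These vectors are irrelevant (and
   unconstrained) outside the corresponding set, and inside it the equations
   below determine them from the edge weights.  Weights may be zero: as
   in-degrees are 0 or 2, this is how a multiple of a single value is formed. *)
Record execution_dag (R : realType) (L : bilinear_algorithm R) :=
    ExecutionDag {
  vertex : finType;
  edge : rel vertex;
  VA : {set vertex};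
  VB : {set vertex};
  VC : {set vertex};
  inA : 'I_(dimA L) -> vertex;
  inB : 'I_(dimB L) -> vertex;
  product : 'I_(brank L) -> vertex;
  out : 'I_(dimC L) -> vertex;
  weight : vertex -> vertex -> R;
  coefA : vertex -> 'cV[R]_(dimA L);
  coefB : vertex -> 'cV[R]_(dimB L);
  coefC : vertex -> 'rV[R]_(brank L);
  VM : {set vertex} := [set product r | r : 'I_(brank L)];

  edge_acyclic : forall x y, edge x y -> ~~ connect edge y x;
  indegree : forall x, #|preds edge x| = 0%N \/ #|preds edge x| = 2%N;
  V_cover : VA :|: VB :|: VC = [set: vertex];
  VAB_disjoint : [disjoint VA & VB];
  VAC_disjoint : [disjoint VA & VC];
  VBC_disjoint : [disjoint VB & VC];
  inA_inj : injective inA;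
  inB_inj : injective inB;
  product_inj : injective product;
  inA_VA : forall i, inA i \in VA;
  inB_VB : forall i, inB i \in VB;
  product_VC : forall r, product r \in VC;
  out_VC : forall h, out h \in VC;
  indegree0 : forall x, #|preds edge x| = 0%N <->
    ((exists i, x = inA i) \/ (exists i, x = inB i));
  edge_kind : forall x y, edge x y ->
    [|| (x \in VA) && (y \in VA), (x \in VB) && (y \in VB),
        (x \in VA) && (y \in VM), (x \in VB) && (y \in VM)
      | (x \in VC) && (y \in VC :\: VM)];
  product_predA : forall r, #|preds edge (product r) :&: VA| = 1%N;
  product_predB : forall r, #|preds edge (product r) :&: VB| = 1%N;

  coefA_in : forall i, coefA (inA i) = delta_mx i 0;
  coefB_in : forall i, coefB (inB i) = delta_mx i 0;
  coefA_add : forall x, x \in VA -> #|preds edge x| = 2%N ->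
    coefA x = \sum_(y in preds edge x) weight y x *: coefA y;
  coefB_add : forall x, x \in VB -> #|preds edge x| = 2%N ->
    coefB x = \sum_(y in preds edge x) weight y x *: coefB y;
  product_operandA : forall r y, edge y (product r) -> y \in VA ->
    coefA y = col r (matA L);
  product_operandB : forall r y, edge y (product r) -> y \in VB ->
    coefB y = col r (matB L);
  coefC_product : forall r, coefC (product r) = delta_mx 0 r;
  coefC_add : forall x, x \in VC :\: VM ->
    coefC x = \sum_(y in preds edge x) weight y x *: coefC y;
  coefC_out : forall h, coefC (out h) = row h (matC L)
}.

Definition vertex_value (R : realType) (L : bilinear_algorithm R)
    (G : execution_dag L) (a : 'cV[R]_(dimA L)) (b : 'cV[R]_(dimB L))
    (x : vertex G) : R :=
  if x \in VA G then ((coefA x)^T *m a) 0 0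
  else if x \in VB G then ((coefB x)^T *m b) 0 0
  else (coefC x *m bilinear_products a b) 0 0.

Section VertexValue.
Variables (R : realType) (L : bilinear_algorithm R) (G : execution_dag L).
Variables (a : 'cV[R]_(dimA L)) (b : 'cV[R]_(dimB L)).
Local Notation value := (@vertex_value R L G a b).

Lemma VB_notinVA x : x \in VB G -> (x \in VA G) = false.
Proof. by move=> xB; rewrite (disjointFl (VAB_disjoint G) xB). Qed.

Lemma VC_notinVA x : x \in VC G -> (x \in VA G) = false.
Proof. by move=> xC; rewrite (disjointFl (VAC_disjoint G) xC). Qed.

Lemma VC_notinVB x : x \in VC G -> (x \in VB G) = false.
Proof. by move=> xC; rewrite (disjointFl (VBC_disjoint G) xC). Qed.

Lemma value_inA i : value (inA G i) = a i 0.
Proof.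
by rewrite /vertex_value inA_VA coefA_in trmx_delta -rowE mxE.
Qed.

Lemma value_inB i : value (inB G i) = b i 0.
Proof.
by rewrite /vertex_value VB_notinVA inB_VB // coefB_in trmx_delta -rowE mxE.
Qed.

Lemma value_product r y z : edge y (product G r) -> edge z (product G r) ->
  y \in VA G -> z \in VB G -> value (product G r) = value y * value z.
Proof.
move=> ey ez yA zB; rewrite /vertex_value yA (VB_notinVA zB) zB (VC_notinVA (product_VC G r)).
rewrite VC_notinVB ?product_VC // coefC_product -rowE.
rewrite (product_operandA ey yA) (product_operandB ez zB) !mxE.
by congr (_ * _); rewrite ?mxE; apply: eq_bigr => i _; rewrite !mxE.
Qed.

Lemma value_add x : x \notin VM G -> #|preds (@edge _ _ G) x| = 2%N ->
  value x = \sum_(y in preds (@edge _ _ G) x) weight y x * value y.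
Proof.
move=> xM x2; have : x \in VA G :|: VB G :|: VC G by rewrite V_cover inE.
rewrite !inE -orbA; case/or3P => xS.
- rewrite /vertex_value xS (coefA_add xS x2) raddf_sum mulmx_suml summxE.
  apply: eq_bigr => y; rewrite inE => /edge_kind.
  rewrite xS in_setD (negPf xM) (disjointFr (VAB_disjoint G) xS).
  rewrite (disjointFr (VAC_disjoint G) xS) !(andbF, andbT, orbF, orbb) /=.
  by move=> ->; rewrite linearZ /= -scalemxAl mxE.
- rewrite /vertex_value VB_notinVA // xS (coefB_add xS x2) raddf_sum mulmx_suml summxE.
  apply: eq_bigr => y; rewrite inE => /edge_kind.
  rewrite xS in_setD (negPf xM) (VB_notinVA xS).
  rewrite (disjointFr (VBC_disjoint G) xS) !(andbF, andbT, orbF, orFb) /=.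
  by move=> yB; rewrite VB_notinVA // yB linearZ /= -scalemxAl mxE.
- rewrite /vertex_value (VC_notinVA xS) (VC_notinVB xS) coefC_add ?in_setD ?xM //.
  rewrite mulmx_suml summxE.
  apply: eq_bigr => y; rewrite inE => /edge_kind.
  rewrite in_setD xM (negPf xM) xS (VC_notinVA xS) (VC_notinVB xS) !(andbF, andbT, orbF, orFb) /=.
  by move=> yC; rewrite (VC_notinVA yC) (VC_notinVB yC) -scalemxAl mxE.
Qed.

Lemma value_out h : value (out G h) = bilinear_apply a b h 0.
Proof.
rewrite /vertex_value (VC_notinVA (out_VC G h)) (VC_notinVB (out_VC G h)).
by rewrite coefC_out -row_mul mxE.
Qed.

End VertexValue.

Inductive step (p : nat) (V : Type) :=
  | Compute (q : 'I_p) (x : V)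
  | Send (from to : 'I_p) (x : V).

Section Steps.
Variables (p : nat) (V : finType) (E : rel V).
Implicit Types (H : {set 'I_p * V}) (st : step p V) (sts : seq (step p V)).

(* A state [H] of the machine is the set of pairs (q, x) such that the value
   of the vertex [x] is present on processor [q]. *)
Definition enabled H st : bool :=
  match st with
  | Compute q x => (#|preds E x| == 2) && [forall y, E y x ==> ((q, y) \in H)]
  | Send q q' x => (q != q') && ((q, x) \in H)
  end.

Definition effect H st : {set 'I_p * V} :=
  match st with
  | Compute q x => (q, x) |: H
  | Send _ q' x => (q', x) |: H
  end.

Fixpoint valid_steps H sts : bool :=
  if sts is st :: sts' then enabled H st && valid_steps (effect H st) sts'
  else true.

Definition final_state H sts : {set 'I_p * V} := foldl effect H sts.

Definition computes (x : V) st : bool :=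
  if st is Compute _ y then y == x else false.

Definition sends (q : 'I_p) st : bool :=
  if st is Send q1 _ _ then q1 == q else false.

Definition receives (q : 'I_p) st : bool :=
  if st is Send _ q2 _ then q2 == q else false.

End Steps.

Definition initial_state (R : realType) (L : bilinear_algorithm R)
    (G : execution_dag L) (p : nat)
    (ownA : 'I_(dimA L) -> 'I_p) (ownB : 'I_(dimB L) -> 'I_p) :
    {set 'I_p * vertex G} :=
  [set (ownA i, inA G i) | i : 'I_(dimA L)] :|:
  [set (ownB i, inB G i) | i : 'I_(dimB L)].

(* A parallel execution is represented by a linearization of its computations
   and point-to-point transfers of single elements: the horizontal cost only
   depends on the number of transfers, and the order ensures that a value is
   used or forwarded only after it has been computed or received. *)
Record schedule (R : realType) (L : bilinear_algorithm R)
    (G : execution_dag L) (p : nat) := Schedule {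
  ownA : 'I_(dimA L) -> 'I_p;
  ownB : 'I_(dimB L) -> 'I_p;
  steps : seq (step p (vertex G));
  steps_valid : valid_steps (@edge _ _ G) (initial_state G ownA ownB) steps;
  computed_once : forall x : vertex G, #|preds (@edge _ _ G) x| = 2%N ->
    count (computes x) steps = 1%N
}.

Definition comm_cost (R : realType) (L : bilinear_algorithm R)
    (G : execution_dag L) (p : nat) (S : schedule G p) : nat :=
  (\max_(q < p) (count (sends q) (steps S) + count (receives q) (steps S)))%N.

Definition balanced (d p : nat) (own : 'I_d -> 'I_p) : Prop :=
  forall q : 'I_p, (#|[set i | own i == q]| * p)%N = d.

(* [ownC] designates the final owner of each output entry; copies left on
   other processors by earlier transfers are disregarded. *)
Definition storage_balanced (R : realType) (L : bilinear_algorithm R)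
    (G : execution_dag L) (p : nat) (S : schedule G p) : Prop :=
  [/\ balanced (ownA S), balanced (ownB S) &
    exists ownC : 'I_(dimC L) -> 'I_p,
      balanced ownC /\
      forall h, (ownC h, out G h) \in
        final_state (initial_state G (ownA S) (ownB S)) (steps S)].

Definition divisibility (R : realType) (L : bilinear_algorithm R) (p : nat) :=
  [/\ p %| dimA L, p %| dimB L, p %| dimC L & p %| brank L]%N.

Definition sym_preserving_cost_Omega (R : realType) (s t v : nat)
    (f : nat -> nat -> R) : Prop :=
  exists (gamma : R) (n0 p0 : nat), 0 < gamma /\
    forall n p : nat, (n0 <= n)%N -> (p0 <= p)%N ->
      divisibility (sym_preserving R s t v n) p ->
      forall (G : execution_dag (sym_preserving R s t v n))
             (S : schedule G p),
        storage_balanced S -> gamma * f n p <= (comm_cost S)%:R.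

(* Main.v *)
(* Some processor [q] computes a set [P] of at least [rank / p] products.  The
   columns of [F^(A)] in [P] are spanned by the coefficient vectors of the
   entries of [a] owned by [q] and of the values [q] receives; likewise for [B],
   and for [C] modulo the outputs owned by [q], with the values [q] sends.  So a
   cost much smaller than the rank of these columns is impossible once the owned
   [1/p] fraction is negligible.  For order [d < w = s + t + v] that rank is at
   least [|P|^(d/w) / 2^w]: each column has at most [2^w] nonzeros, so the rank is
   at least a [2^-w] fraction of the number of nonzero rows, and these are all
   the length-[d] subsequences of the tuples in [P], of which there are at least
   [|P|^(d/w)] by a Loomis-Whitney type inequality. *)

Require Import Defs.
From mathcomp Require Import all_boot all_order all_algebra.
From mathcomp Require Import reals exp.
From mathcomp Require Import zify.
Set Implicit Arguments.
Unset Strict Implicit.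
Unset Printing Implicit Defensive.
Import Order.TTheory GRing.Theory Num.Theory.
Local Open Scope ring_scope.

(** * Loomis-Whitney type inequality for subsequences *)

(** This sums [a i <= b i * G^(1/k)] without roots: if [x1 / y1 <= x2 / y2], the mediant
    [(x1 + x2) / (y1 + y2)] is at most [x2 / y2], so it inherits the bound of the second pair. *)
Lemma sum_expn_le (I : finType) (a b : I -> nat) (k G : nat) : (0 < k)%N ->
  (forall i, (a i ^ k <= b i ^ k * G)%N) ->
  ((\sum_i a i) ^ k <= (\sum_i b i) ^ k * G)%N.
Proof.
move=> k0 le_ab.
apply: (big_ind2 (fun x y => x ^ k <= y ^ k * G)%N) => //.
  by rewrite exp0n.
move=> x1 y1 x2 y2.
wlog le_ratio : x1 x2 y1 y2 / (x1 * y2 <= x2 * y1)%N => [hw h1 h2|h1 h2].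
  case/orP: (leq_total (x1 * y2) (x2 * y1)) => h; first exact: hw.
  by rewrite addnC (addnC y1); apply: hw.
have [y20|y2_gt0] := posnP y2.
  move: h2; rewrite y20 exp0n // mul0n leqn0 expn_eq0 => /andP[/eqP -> _].
  by rewrite !addn0.
rewrite -(@leq_pmul2l (y2 ^ k)) ?expn_gt0 ?y2_gt0 // -expnMn.
apply: (@leq_trans (x2 ^ k * (y1 + y2) ^ k)).
  by rewrite -expnMn leq_exp2r //; nia.
by rewrite mulnCA mulnC leq_mul // mulnC.
Qed.

Lemma card_tuple_cons (T : finType) w (X : {set w.+1.-tuple T}) :
  #|X| = (\sum_a #|[set y : w.-tuple T | cons_tuple a y \in X]|)%N.
Proof.
rewrite -sum1_card (partition_big (@thead w T) xpredT) //=.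
apply: eq_bigr => a _; rewrite sum1dep_card.
rewrite -[RHS](card_imset _ (f := @cons_tuple w T a)); last first.
  by move=> y z /(congr1 val) [] /val_inj.
apply: eq_card => x; rewrite [LHS]inE; apply/andP/imsetP => [[xX /eqP ha]|[y]].
  exists (behead_tuple x); rewrite ?inE -ha.
    by rewrite (tuple_eta x) in xX.
  by rewrite {1}(tuple_eta x).
by rewrite inE => yX ->; rewrite yX theadE.
Qed.

(* Restricting [X] and [S] to tuples with first entry [a] gives by induction
   [|X_a|^d <= |S_a|^w] and [|X_a|^(d+1) <= |S|^w]; interpolating yields
   [|X_a|^(d+1) <= |S_a|^(d+1) |S|^(w-d)], which sums over [a]. *)
Lemma card_subseq_closed (T : finType) w d (X : {set w.-tuple T})
    (S : {set d.-tuple T}) : X != set0 -> (d <= w)%N ->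
  (forall (x : w.-tuple T) (y : d.-tuple T), x \in X -> subseq y x -> y \in S) ->
  (#|X| ^ d <= #|S| ^ w)%N.
Proof.
elim: w d X S => [|w IHw] [|d] X S //= /set0Pn[x0 x0X] le_dw XS.
  rewrite expn0 expn_gt0 card_gt0; apply/orP; left; apply/set0Pn.
  by exists [tuple]; apply: XS x0X _; rewrite sub0seq.
move: le_dw; rewrite ltnS leq_eqVlt => /orP[/eqP eq_dw|lt_dw].
  subst d; rewrite leq_exp2r //; apply/subset_leq_card/subsetP => x xX.
  exact: XS xX _.
have -> : (#|S| ^ w.+1 = #|S| ^ d.+1 * #|S| ^ (w - d))%N.
  by rewrite -expnD; congr (_ ^ _)%N; lia.
rewrite (card_tuple_cons X) {1}(card_tuple_cons S).
apply: sum_expn_le => // a.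
set Xa := [set _ | _]; set Sa := [set _ | _].
have [->|Xa0] := eqVneq Xa set0; first by rewrite cards0 exp0n.
(* Here the head [a] is prepended to a length-[d] subsequence of a tail; in [h2] a length-[d.+1]
   subsequence is taken inside the tail. *)
have h1 : (#|Xa| ^ d <= #|Sa| ^ w)%N.
  apply: IHw => //; first exact: ltnW.
  move=> x y; rewrite !inE => xX yx; apply: XS xX _ => /=.
  by rewrite eqxx.
have h2 : (#|Xa| ^ d.+1 <= #|S| ^ w)%N.
  apply: IHw => //.
  move=> x y; rewrite inE => xX yx; apply: XS xX _.
  exact: subseq_trans yx (subseq_cons _ _).
have w0 : (0 < w)%N by apply: leq_ltn_trans lt_dw.
rewrite -(leq_exp2r _ _ w0).
have -> : ((#|Xa| ^ d.+1) ^ w = (#|Xa| ^ d) ^ d.+1 * (#|Xa| ^ d.+1) ^ (w - d))%N.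
  by rewrite -!expnM -expnD; congr (_ ^ _)%N; nia.
have -> : ((#|Sa| ^ d.+1 * #|S| ^ (w - d)) ^ w =
    (#|Sa| ^ w) ^ d.+1 * (#|S| ^ w) ^ (w - d))%N.
  by rewrite expnMn -!expnM; congr (_ ^ _ * _ ^ _)%N; apply: mulnC.
by apply: leq_mul; rewrite leq_exp2r // subn_gt0; apply: leq_trans lt_dw.
Qed.

(** * Ranks of selected columns *)

(** Right multiplication zeroes the columns outside [P] but keeps the shape of the matrix, which
    avoids reindexing by [P]. *)
Definition col_proj (R : realType) k (P : {set 'I_k}) : 'M[R]_k :=
  diag_mx (\row_c (c \in P)%:R).

Lemma mul_col_projE (R : realType) m k (M : 'M[R]_(m, k)) (P : {set 'I_k}) i j :
  (M *m col_proj R P) i j = M i j * (j \in P)%:R.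
Proof.
rewrite mxE (bigD1 j) //= big1 ?addr0 => [|l lj]; first by rewrite !mxE eqxx.
by rewrite !mxE (negPf lj) mulr0.
Qed.

(* The rows of [M] meeting a column of [P] already meet a column of a basis of
   the span of these columns. *)
Lemma card_nonzero_rows (R : realType) m k (M : 'M[R]_(m, k)) (P : {set 'I_k}) (N : nat) :
  (forall c, #|[set j | M j c != 0%R]| <= N)%N ->
  (#|[set j | [exists c in P, M j c != 0%R]]| <=
     \rank (M *m col_proj R P) * N)%N.
Proof.
move=> nzN; set D := col_proj R P; rewrite -mxrank_tr.
set A := (M *m D)^T.
have AE c j : A c j = M j c * (c \in P)%:R.
  by rewrite mxE mul_col_projE.
set f := maxrankfun A.
apply: (@leq_trans #|\bigcup_(i < \rank A) [set j | M j (f i) != 0]|).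
  apply/subset_leq_card/subsetP => j; rewrite inE => /existsP[c /andP[cP nz]].
  apply/bigcupP.
  case: (pickP (fun i => M j (f i) != 0)) => [i hi|nz0]; first by exists i; rewrite ?inE.
  (* Column [c] is a combination of the basis columns [f i]; if these all vanish at [j], so does
     column [c]. *)
  have : (row c A <= rowsub f A)%MS by rewrite eq_maxrowsub row_sub.
  move=> /submxP[u /(congr1 (fun z : 'rV_m => z 0 j))].
  rewrite mxE AE cP mulr1 mxE big1 => [z|i _]; first by rewrite z eqxx in nz.
  by rewrite mxE AE (eqP (negbFE (nz0 i))) mul0r mulr0.
apply: (@leq_trans (\sum_(i < \rank A) N)%N); last by rewrite sum_nat_const card_ord.
elim/big_ind2: _ => // [|X1 n1 X2 n2 h1 h2]; first by rewrite cards0.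
by apply: leq_trans (leq_card_setU _ _) _; apply: leq_add.
Qed.

(** * What a group of processors can know during an execution *)

Section Machine.
Variables (R : realType) (p : nat) (V : finType) (E : rel V).
Implicit Types (H : {set 'I_p * V}) (sts : seq (step p V)).

Definition computes_on (q : 'I_p) (x : V) (st : step p V) : bool :=
  if st is Compute q' y then (q' == q) && (y == x) else false.

(** [Z] is a group of processors treated as one machine: [q] alone for what [q] receives, all others
    for what [q] sends. *)
Definition crossing (Z : pred 'I_p) (st : step p V) : bool :=
  if st is Send q q' _ then ~~ Z q && Z q' else false.

Lemma effect_sub H st : H \subset effect H st.
Proof. by case: st => [q x|q q' x] /=; apply: subsetUr. Qed.

Lemma final_state_sub H sts : H \subset final_state H sts.
Proof.
elim: sts H => [|st sts IH] H /=; first exact: subxx.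
exact: subset_trans (effect_sub H st) (IH _).
Qed.

(** States only grow, so an operand present when [x] is computed is still there at the end. *)
Lemma operand_present H sts q x y : valid_steps E H sts ->
  has (computes_on q x) sts -> E y x -> (q, y) \in final_state H sts.
Proof.
elim: sts H => //= st sts IH H /andP[en val] /orP[|hs]; last exact: IH.
case: st en val => //= q' x' /andP[_ /forallP en] _ /andP[/eqP <- /eqP xx] Eyx.
apply: (subsetP (subset_trans (effect_sub H (Compute q' x')) (final_state_sub _ sts))).
by have := en y; rewrite xx Eyx.
Qed.

Lemma computes_on_uniq sts q q' x : count (computes x) sts = 1%N ->
  has (computes_on q x) sts -> has (computes_on q' x) sts -> q = q'.
Proof.
move=> c1; rewrite !has_count => hq hq'; apply/eqP; apply: contraTT isT => ne.
have := count_predUI (computes_on q x) (computes_on q' x) sts.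
rewrite (eq_count (a2 := pred0) (a1 := predI _ _)); last first.
  case=> // q'' y /=; apply: contraNF ne.
  by case/andP => /andP[/eqP <- _] /andP[/eqP <- _].
rewrite count_pred0 addn0 => cU.
suff : (count (predU (computes_on q x) (computes_on q' x)) sts <= 1)%N by rewrite cU; lia.
rewrite -c1; apply: sub_count; case=> //= q'' y.
by case/orP => /andP[].
Qed.

Lemma has_computes sts x : has (computes x) sts ->
  exists q, has (computes_on q x) sts.
Proof.
elim: sts => //= st sts IH /orP[|/IH[q hq]]; last by exists q; rewrite hq orbT.
by case: st => //= q y /eqP ->; exists q; rewrite !eqxx.
Qed.

(* [U] is a set of vertices with coefficient vectors [c]; a processor of [Z]
   can leave [W0] only through a value that enters [Z] in a message. *)
Lemma known_span_rank m (Z : pred 'I_p) (U : {set V}) (c : V -> 'rV[R]_m)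
    (W0 : 'M[R]_m) H sts :
  (forall q x, Z q -> x \in U -> (q, x) \in H -> (c x <= W0)%MS) ->
  (forall q x (W : 'M[R]_m), Z q -> x \in U -> has (computes_on q x) sts ->
     #|preds E x| = 2%N -> (forall y, E y x -> y \in U -> (c y <= W)%MS) ->
     (c x <= W)%MS) ->
  valid_steps E H sts ->
  exists W : 'M[R]_m,
    (\rank W <= \rank W0 + count (crossing Z) sts)%N /\
    forall q x, Z q -> x \in U -> (q, x) \in final_state H sts -> (c x <= W)%MS.
Proof.
elim: sts H W0 => [|st sts IH] H W0 H0 Hc /=.
  by move=> _; exists W0; rewrite addn0.
case/andP => en val.
have Hc' q x (W : 'M[R]_m) : Z q -> x \in U -> has (computes_on q x) sts ->
     #|preds E x| = 2%N -> (forall y, E y x -> y \in U -> (c y <= W)%MS) ->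
     (c x <= W)%MS.
  by move=> Zq xU hs; apply: Hc Zq xU _; rewrite /= hs orbT.
case: st en val Hc => [q0 x0|q1 q2 x0] /=.
  case/andP => /eqP d2 /forallP pres val Hc; apply: IH Hc' val => q x Zq xU.
  rewrite !inE xpair_eqE => /orP[/andP[/eqP qq /eqP xx]|]; last exact: H0.
  subst q x; apply: (Hc q0) => //; first by rewrite !eqxx.
  by move=> y Eyx yU; apply: (H0 q0) => //; have := pres y; rewrite Eyx.
case/andP => ne pres val Hc.
(* A message leaving [Z] is irrelevant and one inside [Z] carries a vector already spanned; only a
   message entering [Z] can cost a dimension. *)
have [crs|ncrs] := boolP (~~ Z q1 && Z q2); last first.
  rewrite add0n; apply: IH Hc' val => q x Zq xU.
  rewrite !inE xpair_eqE => /orP[/andP[/eqP qq /eqP xx]|]; last exact: H0.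
  subst q x; rewrite Zq andbT negbK in ncrs; exact: H0 pres.
have [|W [rW HW]] := IH _ (W0 + <<c x0>>)%MS _ Hc' val.
  move=> q x Zq xU.
  rewrite !inE xpair_eqE => /orP[/andP[_ /eqP ->]|].
    by rewrite (submx_trans _ (addsmxSr _ _)) // genmxE.
  by move=> /(H0 _ _ Zq xU) h; apply: submx_trans h (addsmxSl _ _).
exists W; split=> //; apply: leq_trans rW _.
rewrite addnA leq_add2r; apply: leq_trans (mxrank_adds_leqif _ _) _.
by rewrite leq_add2l mxrank_gen rank_leq_row.
Qed.

End Machine.

(** * Rank bounds for the products of one processor *)

Lemma rank_span_le (R : realType) m (I : finType) (A : {set I}) (f : I -> 'rV[R]_m) :
  (\rank (\sum_(i in A) <<f i>>)%MS <= #|A|)%N.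
Proof.
rewrite -sum1_card; elim/big_rec2: _ => [|i k W _ h]; first by rewrite mxrank0.
apply: leq_trans (mxrank_adds_leqif _ _) _.
by apply: leq_add h; rewrite mxrank_gen rank_leq_row.
Qed.

Section Schedules.
Variables (R : realType) (L : bilinear_algorithm R) (G : execution_dag L).
Variables (p : nat) (S : schedule G p).

Definition computed_products (q : 'I_p) : {set 'I_(brank L)} :=
  [set r | has (computes_on q (product G r)) (steps S)].

Local Notation E := (@edge _ _ G).

Lemma product_indegree r : #|preds E (product G r)| = 2%N.
Proof.
case: (indegree (product G r)) => // h0.
have := product_predA G r; move/eqP: h0; rewrite cards_eq0 => /eqP ->.
by rewrite set0I cards0.
Qed.

(** Together with [edge_VB] and [edge_VC], this keeps the recursion for coefficient vectors inside
    one class of vertices. *)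
Lemma edge_VA x y : edge y x -> x \in VA G -> y \in VA G.
Proof.
move=> /edge_kind + xA; rewrite in_setD xA (disjointFr (VAB_disjoint G) xA).
rewrite (disjointFr (VAC_disjoint G) xA) !andbF !andbT !orFb orbF.
case/or3P => // /andP[_ /imsetP[r _ xr]]; have := product_VC G r;
  by rewrite -xr (disjointFr (VAC_disjoint G) xA).
Qed.

Lemma edge_VB x y : edge y x -> x \in VB G -> y \in VB G.
Proof.
move=> /edge_kind + xB; rewrite in_setD xB (VB_notinVA xB).
rewrite (disjointFr (VBC_disjoint G) xB) !andbF !andbT !orFb orbF.
case/or3P => // /andP[_ /imsetP[r _ xr]]; have := product_VC G r;
  by rewrite -xr (disjointFr (VBC_disjoint G) xB).
Qed.

Lemma edge_VC x y : edge y x -> x \in VC G :\: VM G -> y \in VC G.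
Proof.
move=> /edge_kind + /setDP[xC xM]; rewrite in_setD xC (negPf xM).
rewrite (VC_notinVA xC) (VC_notinVB xC) !andbF !orFb.
by case/andP.
Qed.

Lemma busy_processor : (0 < p)%N ->
  exists q, (brank L <= #|computed_products q| * p)%N.
Proof.
move=> p0.
case: (pickP (fun q => brank L <= #|computed_products q| * p)%N) => [q|small].
  by exists q.
have le_sum : (brank L <= \sum_q #|computed_products q|)%N.
  rewrite -[X in (X <= _)%N]card_ord -cardsT.
  apply: (@leq_trans #|\bigcup_q computed_products q|).
    apply/subset_leq_card/subsetP => r _.
    have : has (computes (product G r)) (steps S).
      by rewrite has_count computed_once // product_indegree.
    case/has_computes => q hq.
    by apply/bigcupP; exists q; rewrite ?inE.
  elim/big_ind2: _ => // [|X1 n1 X2 n2 h1 h2]; first by rewrite cards0.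
  by apply: leq_trans (leq_card_setU _ _) _; apply: leq_add.
suff : (\sum_(q < p) #|computed_products q| * p < \sum_(q < p) brank L)%N.
  by rewrite sum_nat_const card_ord -big_distrl /= mulnC ltn_pmul2l // ltnNge le_sum.
(* Strictness comes from one isolated summand, available as [0 < p]. *)
rewrite (bigD1 (Ordinal p0)) //= [in X in (_ < X)%N](bigD1 (Ordinal p0)) //=.
have lt_q q : (#|computed_products q| * p < brank L)%N by rewrite ltnNge small.
rewrite -addSn leq_add // leq_sum // => q _; exact: ltnW.
Qed.

Lemma receives_le_cost q : (count (receives q) (steps S) <= comm_cost S)%N.
Proof. exact: leq_trans (leq_addl _ _) (leq_bigmax q). Qed.

Lemma sends_le_cost q : (count (sends q) (steps S) <= comm_cost S)%N.
Proof. exact: leq_trans (leq_addr _ _) (leq_bigmax q). Qed.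

(** Apply [known_span_rank] to the group [q] alone: it starts with the unit vectors of its own
    entries, and a crossing message is one that [q] receives. The operand of a product computed by
    [q] is on [q], and its vector is the corresponding column. *)
Lemma matA_rank_le_cost q :
  (\rank (matA L *m col_proj R (computed_products q)) <=
     #|[set i | ownA S i == q]| + comm_cost S)%N.
Proof.
set W0 := (\sum_(i in [set i | ownA S i == q]) <<(coefA (inA G i))^T>>)%MS.
have [||W [rW HW]] := @known_span_rank _ _ _ E _ (pred1 q) (VA G)
  (fun x => (coefA x)^T) W0 _ (steps S) _ _ (steps_valid S).
- move=> _ x /eqP -> xA; rewrite inE => /orP[] /imsetP[i _ [qi xi]].
    by rewrite (sumsmx_sup i) ?inE ?qi ?xi // genmxE.
  by have := inB_VB G i; rewrite -xi (disjointFr (VAB_disjoint G) xA).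
- move=> _ x W /eqP -> xA _ d2 HW; rewrite coefA_add // linear_sum.
  apply: summx_sub => y; rewrite inE => Eyx.
  by rewrite linearZ scalemx_sub // HW // (edge_VA Eyx).
apply: (@leq_trans (\rank W)); last first.
  apply: leq_trans rW (leq_add (rank_span_le _ _) _).
  apply: leq_trans (receives_le_cost q); apply: sub_count.
  by case=> //= q1 q2 _ /andP[].
rewrite -mxrank_tr; apply/mxrankS/row_subP => r.
have [rP|rNP] := boolP (r \in computed_products q); last first.
  suff -> : row r (matA L *m col_proj R (computed_products q))^T = 0 by apply: sub0mx.
  by apply/rowP => j; rewrite mxE mxE mul_col_projE (negPf rNP) mulr0 mxE.
have /eqP/cards1P[y yE] := product_predA G r.
have : y \in preds E (product G r) :&: VA G by rewrite yE set11.
rewrite !inE => /andP[Eyr yA].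
suff -> : row r (matA L *m col_proj R (computed_products q))^T = (coefA y)^T.
  apply: (HW q) => //=.
  by apply: operand_present (steps_valid S) _ Eyr; rewrite inE in rP.
rewrite (product_operandA Eyr yA).
by apply/rowP => j; rewrite mxE mxE mul_col_projE rP mulr1 !mxE.
Qed.

Lemma matB_rank_le_cost q :
  (\rank (matB L *m col_proj R (computed_products q)) <=
     #|[set i | ownB S i == q]| + comm_cost S)%N.
Proof.
set W0 := (\sum_(i in [set i | ownB S i == q]) <<(Defs.coefB (inB G i))^T>>)%MS.
have [||W [rW HW]] := @known_span_rank _ _ _ E _ (pred1 q) (VB G)
  (fun x => (Defs.coefB x)^T) W0 _ (steps S) _ _ (steps_valid S).
- move=> _ x /eqP -> xB; rewrite inE => /orP[] /imsetP[i _ [qi xi]].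
    by have := inA_VA G i; rewrite -xi (VB_notinVA xB).
  by rewrite (sumsmx_sup i) ?inE ?qi ?xi // genmxE.
- move=> _ x W /eqP -> xB _ d2 HW; rewrite coefB_add // linear_sum.
  apply: summx_sub => y; rewrite inE => Eyx.
  by rewrite linearZ scalemx_sub // HW // (edge_VB Eyx).
apply: (@leq_trans (\rank W)); last first.
  apply: leq_trans rW (leq_add (rank_span_le _ _) _).
  apply: leq_trans (receives_le_cost q); apply: sub_count.
  by case=> //= q1 q2 _ /andP[].
rewrite -mxrank_tr; apply/mxrankS/row_subP => r.
have [rP|rNP] := boolP (r \in computed_products q); last first.
  suff -> : row r (matB L *m col_proj R (computed_products q))^T = 0 by apply: sub0mx.
  by apply/rowP => j; rewrite mxE mxE mul_col_projE (negPf rNP) mulr0 mxE.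
have /eqP/cards1P[y yE] := product_predB G r.
have : y \in preds E (product G r) :&: VB G by rewrite yE set11.
rewrite !inE => /andP[Eyr yB].
suff -> : row r (matB L *m col_proj R (computed_products q))^T = (Defs.coefB y)^T.
  apply: (HW q) => //=.
  by apply: operand_present (steps_valid S) _ Eyr; rewrite inE in rP.
rewrite (product_operandB Eyr yB).
by apply/rowP => j; rewrite mxE mxE mul_col_projE rP mulr1 !mxE.
Qed.

(* Modulo the products that [q] does not compute, the other processors only
   know what [q] sent. *)
Lemma matC_rank_le_cost q (ownC : 'I_(dimC L) -> 'I_p) :
  (forall h, (ownC h, out G h) \in
     final_state (initial_state G (ownA S) (ownB S)) (steps S)) ->
  (\rank (matC L *m col_proj R (computed_products q)) <=
     #|[set h | ownC h == q]| + comm_cost S)%N.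
Proof.
move=> ownCP; set D := col_proj R _.
(* The other processors start from the zero space: initially they hold only inputs, which are not in
   [VC]. *)
have [||W [rW HW]] := @known_span_rank _ _ _ E _ (predC1 q) (VC G)
  (fun x => Defs.coefC x *m D) 0 _ (steps S) _ _ (steps_valid S).
- move=> q' x _ xC; rewrite inE => /orP[] /imsetP[i _ [_ xi]].
    by have := inA_VA G i; rewrite -xi (VC_notinVA xC).
  by have := inB_VB G i; rewrite -xi (VC_notinVB xC).
- move=> q' x W /= q'q xC hs d2 HW.
  have [/imsetP[r _ xr]|xM] := boolP (x \in VM G).
    (* A product computed outside [q] is not also computed by [q], so [D] kills its vector. *)
    suff -> : Defs.coefC x *m D = 0 by apply: sub0mx.
    apply/rowP => j; rewrite /D mul_col_projE xr Defs.coefC_product !mxE eqxx /=.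
    have [->|//] := eqVneq j r; last by rewrite mul0r.
    rewrite mul1r; case: (boolP (r \in _)) => //; rewrite inE => hq; case/eqP: q'q.
    by apply: computes_on_uniq (computed_once S d2) hs _; rewrite xr.
  have xCM : x \in VC G :\: VM G by rewrite inE xM.
  rewrite Defs.coefC_add // mulmx_suml; apply: summx_sub => y; rewrite inE => Eyx.
  by rewrite -scalemxAl scalemx_sub // HW // (edge_VC Eyx).
(* Outputs owned by [q] cost one dimension each; all others end up outside [q] and lie in [W]. *)
set W0 := (\sum_(h in [set h | ownC h == q]) <<row h (matC L *m D)>>)%MS.
apply: (@leq_trans (\rank (W0 + W)%MS)); last first.
  apply: leq_trans (mxrank_adds_leqif _ _) _.
  apply: leq_add (rank_span_le _ _) _.
  rewrite mxrank0 add0n in rW; apply: leq_trans rW _.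
  apply: leq_trans (sends_le_cost q); apply: sub_count.
  by case=> //= q1 q2 _ /andP[]; rewrite negbK.
apply/mxrankS/row_subP => h.
have [hq|hq] := eqVneq (ownC h) q.
  apply: submx_trans (addsmxSl _ _).
  by rewrite (sumsmx_sup h) ?inE ?hq // genmxE.
apply: submx_trans (addsmxSr _ _).
rewrite row_mul -(Defs.coefC_out G).
exact: HW hq (out_VC G h) (ownCP h).
Qed.

End Schedules.

(** * Counting nondecreasing tuples; zero pattern of the factors *)

Lemma expn_le_ffact n m : (n.+1 ^ m <= (m + n) ^_ m)%N.
Proof.
elim: m => [|m IH] //; rewrite expnS addSn ffactSS.
by apply: leq_mul => //; rewrite ltnS leq_addl.
Qed.

Lemma card_incr_tuple_le n d : (#|{: incr_tuple n d}| <= n ^ d)%N.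
Proof.
rewrite card_sig; apply: leq_trans (max_card _) _.
by rewrite card_tuple card_ord.
Qed.

Lemma expn_le_card_incr_tuple n w : (0 < n)%N ->
  (n ^ w <= #|{: incr_tuple n w}| * w`!)%N.
Proof.
case: n => // n _; rewrite card_sig.
have -> : #|[pred k : w.-tuple 'I_n.+1 | sorted leq (map val k)]| = 'C(w + n, w).
  by rewrite -card_sorted_tuples cardsE.
by rewrite bin_ffact expn_le_ffact.
Qed.

Lemma rho_neq0 (R : realType) (T : eqType) (k : seq T) : rho R k != 0.
Proof.
rewrite /rho mulf_neq0 ?invr_neq0 ?pnatr_eq0 -?lt0n ?fact_gt0 //.
by apply: prodn_gt0 => x; exact: fact_gt0.
Qed.

(** A mask cutting [j] out of [i] has a complement of length [r], because [d = q + r]; hence the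
    [pick] succeeds exactly on subsequences. *)
Lemma split_coef_neq0 (R : realType) n q r d (f : r.-tuple 'I_n -> R)
    (j : incr_tuple n q) (i : incr_tuple n d) :
  (forall x, f x != 0) -> d = (q + r)%N ->
  (split_coef f j i != 0) = subseq (val j) (val i).
Proof.
move=> f0 dE; rewrite /split_coef; case: pickP => [j'|none].
  rewrite inE => /existsP[m /andP[/eqP jm _]].
  by rewrite f0; apply/esym; move: jm => /= ->; apply: mask_subseq.
rewrite eqxx; apply/esym/negbTE/negP => /subseqP[m sm jm].
have sm' : size [seq ~~ b | b <- m] = size (val i) by rewrite size_map.
have sr : size (mask [seq ~~ b | b <- m] (val i)) == r.
  have mq : count id m = q by rewrite -(size_mask sm) -jm size_tuple.
  rewrite size_mask // count_map -(eqn_add2l q) -dE -{1}mq count_predC.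
  by rewrite sm size_tuple.
have smt : size m == size (val i) by rewrite sm.
have := negbT (none (Tuple sr)); rewrite inE => /negP; apply.
by apply/existsP; exists (Tuple smt); rewrite /= jm !eqxx.
Qed.

(** Each subsequence is recovered from a mask chosen for it by [g], and there are [2 ^ w] masks. *)
Lemma card_subseq_incr_tuple n d w (x : w.-tuple 'I_n) :
  (#|[set j : incr_tuple n d | subseq (val j) x]| <= 2 ^ w)%N.
Proof.
pose g (j : incr_tuple n d) : w.-tuple bool :=
  odflt [tuple of nseq w false]
    [pick m : w.-tuple bool | mask m x == val j :> seq 'I_n].
have gE (j : incr_tuple n d) : subseq (val j) x -> mask (g j) x = val j.
  rewrite /g; case: pickP => [m /eqP //|none] /subseqP[m sm jm].
  have smt : size m == w by rewrite sm size_tuple.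
  by have := none (Tuple smt); rewrite /= -jm eqxx.
rewrite -(card_in_imset (f := g)) => [|j1 j2]; last first.
  rewrite !inE => /gE h1 /gE h2 g12; apply/val_inj/val_inj.
  by rewrite -[LHS]h1 -[RHS]h2 g12.
by apply: leq_trans (max_card _) _; rewrite card_tuple card_bool.
Qed.

Definition subseq_pattern (R : realType) n d w
    (M : 'M[R]_(#|{: incr_tuple n d}|, #|{: incr_tuple n w}|)) : Prop :=
  forall j i, (M j i != 0) =
    subseq (val (enum_val j) : d.-tuple 'I_n) (val (enum_val i) : w.-tuple 'I_n).

Lemma rank_subseq_pattern (R : realType) n d w
    (M : 'M[R]_(#|{: incr_tuple n d}|, #|{: incr_tuple n w}|))
    (P : {set 'I_#|{: incr_tuple n w}|}) :
  subseq_pattern M -> (d <= w)%N -> P != set0 ->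
  (#|P| ^ d <= (\rank (M *m col_proj R P) * 2 ^ w) ^ w)%N.
Proof.
move=> MP le_dw P0.
have w_col c : (#|[set j | M j c != 0%R]| <= 2 ^ w)%N.
  apply: leq_trans (card_subseq_incr_tuple d (val (enum_val c))).
  rewrite -(card_imset _ enum_val_inj); apply/subset_leq_card/subsetP => x.
  by case/imsetP => j + ->; rewrite !inE MP.
have := card_nonzero_rows P w_col; set rows := [set _ | _] => le_rows.
set X : {set w.-tuple 'I_n} := [set val (enum_val i) | i in P].
set S : {set d.-tuple 'I_n} := [set val (enum_val j) | j in rows].
have -> : #|P| = #|X|.
  by apply/esym/card_imset => i j /val_inj /enum_val_inj.
apply: (@leq_trans (#|S| ^ w)); last first.
  have leq_expl a b e : (a <= b -> a ^ e <= b ^ e)%N.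
    by case: e => // e; rewrite leq_exp2r.
  exact/leq_expl/(leq_trans (leq_imset_card _ _) le_rows).
apply: card_subseq_closed => //.
  by have /set0Pn[i iP] := P0; apply/set0Pn; exists (val (enum_val i)); apply: imset_f.
move=> _ y /imsetP[i iP ->] yi.
(* A subsequence of a nondecreasing tuple is nondecreasing, so it does index a row, one that is
   nonzero in column [i]. *)
have sy : sorted leq (map val y).
  apply: (subseq_sorted leq_trans (map_subseq val yi)).
  exact: (valP (enum_val i)).
apply/imsetP; exists (enum_rank (exist _ y sy : incr_tuple n d)); last first.
  by rewrite enum_rankK.
rewrite inE; apply/existsP; exists i.
by rewrite iP MP enum_rankK.
Qed.

(** * Numerical combination and asymptotic bounds *)

(** Below, [k] of the [D] products belong to the busy processor, which owns [own] of the [c]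
    entries; [N] is [2 ^ w] and [f] is [w!]. With [Y = (n^w / p)^(d/w)], the rank is at least
    [Y / (N f)] and the owned share at most half of that, so [W >= rk - own] is at least the other
    half. *)
Lemma cost_lower_bound (R : realType) (n d w p own rk k D c W N f : nat) :
  (d < w)%N -> (0 < p)%N -> ((2 * N * f) ^ w <= p)%N -> (0 < N)%N -> (0 < f)%N ->
  (own * p = c)%N -> (c <= n ^ d)%N -> (D <= k * p)%N -> (n ^ w <= D * f)%N ->
  (k ^ d <= (rk * N) ^ w)%N -> (rk <= own + W)%N ->
  (2 * N * f)%:R^-1 * ((n%:R ^+ w / p%:R : R) `^ (d%:R / w%:R)) <= W%:R.
Proof.
move=> dw p0 p_big N0 f0 ownE c_le kD nD rk_ge rk_le.
have w0 : (0 < w)%N by apply: leq_ltn_trans dw.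
have pR : p%:R != 0 :> R by rewrite pnatr_eq0 -lt0n.
set Y := _ `^ _.
have Y0 : 0 <= Y by apply: powR_ge0.
(* Comparisons with [Y] are raised to the power [w] and multiplied by [p ^ d], which turns them into
   inequalities in [nat]. *)
have YE : Y ^+ w * p%:R ^+ d = (n ^ (w * d))%:R.
  rewrite -powR_mulrn // -powRrM divfK ?pnatr_eq0 -?lt0n //.
  rewrite powR_mulrn ?divr_ge0 ?exprn_ge0 //.
  by rewrite expr_div_n mulfVK ?expf_neq0 // natrX exprM.
have pd0 : 0 < p%:R ^+ d :> R by rewrite exprn_gt0 // ltr0n.
(* Large [p] and [d < w] enter here: [(2 N f)^w p^d <= p^(d+1) <= p^w]. *)
have own_le : (2 * N * f * own)%:R <= Y.
  rewrite -(ler_pXn2r w0) ?nnegrE // -(ler_pM2r pd0) YE -!natrX -natrM ler_nat.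
  apply: (@leq_trans (p ^ w * own ^ w)).
    rewrite expnMn mulnAC leq_mul2r; apply/orP; right.
    apply: (@leq_trans (p * p ^ d)); first by rewrite leq_mul2r p_big orbT.
    by rewrite -expnS leq_pexp2l.
  rewrite -expnMn (mulnC p) ownE (mulnC w) expnM.
  by rewrite leq_exp2r.
(* [n^(w d) <= (f k p)^d], and [f^d <= f^w] turns the factor [f] into a [w]-th power. *)
have le_rk : Y <= (f * (rk * N))%:R.
  rewrite -(ler_pXn2r w0) ?nnegrE // -(ler_pM2r pd0) YE -!natrX -natrM ler_nat.
  apply: (@leq_trans (f ^ d * k ^ d * p ^ d)).
    rewrite -!expnMn expnM; case: (posnP d) => [-> //|d0].
    rewrite leq_exp2r // -mulnA mulnC; apply: leq_trans nD _.
    by rewrite leq_mul2r kD orbT.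
  rewrite leq_mul2r; apply/orP; right; rewrite expnMn.
  by apply: leq_mul rk_ge; rewrite leq_pexp2l // ltnW.
rewrite mulrC ler_pdivrMr ?ltr0n ?muln_gt0 ?N0 ?f0 //.
have : (2 * (f * (rk * N)))%:R <= (2 * N * f * own)%:R + W%:R * (2 * N * f)%:R :> R.
  rewrite -natrM -natrD ler_nat (mulnC W) -mulnDr (mulnC rk) !mulnA (mulnAC 2%N).
  by rewrite leq_mul2l rk_le orbT.
rewrite natrM => h.
rewrite -(lerD2l Y) -mulr2n -(mulr_natl Y).
apply: le_trans (ler_wpM2l _ le_rk) _ => //.
by apply: le_trans h _; rewrite lerD2r.
Qed.

Section CostOmega.
Variables (R : realType) (s t v : nat).
Local Notation Phi n := (sym_preserving R s t v n).
Local Notation w := (s + t + v)%N.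

(** [M] stands for any one of the three factor matrices, [d] for the order of its tensor. *)
Lemma cost_Omega_of_rank d
    (M : forall n, 'M[R]_(#|{: incr_tuple n d}|, #|{: incr_tuple n w}|)) :
  (d < w)%N -> (forall n, subseq_pattern (M n)) ->
  (forall n p (G : execution_dag (Phi n)) (S : schedule G p) (q : 'I_p),
     storage_balanced S -> exists2 own : nat,
       (own * p)%N = #|{: incr_tuple n d}| &
       (\rank (M n *m col_proj R (computed_products S q)) <= own + comm_cost S)%N) ->
  sym_preserving_cost_Omega s t v (fun n p : nat =>
    ((n%:R ^+ w / p%:R : R) `^ (d%:R / w%:R))).
Proof.
move=> dw MP rankP.
have f0 := fact_gt0 w; have N0 : (0 < 2 ^ w)%N by rewrite expn_gt0.
(* The constant and the threshold on [p] are those of [cost_lower_bound]; [1 <= n] ensures that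
   there are products, so the busy processor computes at least one. *)
exists (2 * 2 ^ w * w`!)%:R^-1, 1%N, ((2 * 2 ^ w * w`!) ^ w)%N; split.
  by rewrite invr_gt0 ltr0n !muln_gt0 N0 f0.
move=> n p n0 p_big _ G S balS.
have p0 : (0 < p)%N by apply: leq_trans p_big; rewrite expn_gt0 !muln_gt0 N0 f0.
have [q le_q] := busy_processor S p0.
have [own ownE rk_le] := rankP n p G S q balS.
have D_ge := expn_le_card_incr_tuple w n0.
apply: (cost_lower_bound R dw p0 p_big N0 f0 ownE (card_incr_tuple_le n d) le_q D_ge _ rk_le).
apply: rank_subseq_pattern (MP n) (ltnW dw) _.
apply/negP => /eqP P0; move: le_q; rewrite P0 cards0 mul0n leqn0 => /eqP D0.
by move: D_ge; rewrite /= in D0; rewrite D0 mul0n leqn0 expn_eq0 -leqn0 leqNgt n0.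
Qed.

(** Positivity of the parameter missing from the order gives [d < w], here and in the next two
    lemmas. *)
Lemma cost_Omega_A : (0 < t)%N ->
  sym_preserving_cost_Omega s t v (fun n p : nat =>
    ((n%:R ^+ w / p%:R : R) `^ ((s + v)%:R / w%:R))).
Proof.
move=> t0; apply: (@cost_Omega_of_rank _ (fun n => matA (Phi n))); first lia.
  move=> n j i; rewrite mxE; apply: split_coef_neq0; last by lia.
  by move=> x; rewrite mulf_neq0 ?invr_neq0 ?rho_neq0 // pnatr_eq0 -lt0n fact_gt0.
move=> n p G S q [balA _ _]; exists #|[set i | ownA S i == q]|; first exact: balA.
exact: matA_rank_le_cost.
Qed.

Lemma cost_Omega_B : (0 < s)%N ->
  sym_preserving_cost_Omega s t v (fun n p : nat =>
    ((n%:R ^+ w / p%:R : R) `^ ((v + t)%:R / w%:R))).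
Proof.
move=> s0; apply: (@cost_Omega_of_rank _ (fun n => matB (Phi n))); first lia.
  move=> n j i; rewrite mxE; apply: split_coef_neq0; last by lia.
  by move=> x; rewrite mulf_neq0 ?invr_neq0 ?rho_neq0 // pnatr_eq0 -lt0n fact_gt0.
move=> n p G S q [_ balB _]; exists #|[set i | ownB S i == q]|; first exact: balB.
exact: matB_rank_le_cost.
Qed.

Lemma cost_Omega_C : (0 < v)%N ->
  sym_preserving_cost_Omega s t v (fun n p : nat =>
    ((n%:R ^+ w / p%:R : R) `^ ((s + t)%:R / w%:R))).
Proof.
move=> v0; apply: (@cost_Omega_of_rank _ (fun n => matC (Phi n))); first lia.
  move=> n j i; rewrite mxE; apply: split_coef_neq0; last by lia.
  by move=> x; rewrite mulf_neq0 ?rho_neq0 // mulf_neq0 // pnatr_eq0 -lt0n fact_gt0.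
move=> n p G S q [_ _ [ownC [balC ownCP]]].
exists #|[set h | ownC h == q]|; first exact: balC.
exact: matC_rank_le_cost.
Qed.

End CostOmega.

Theorem theorem6p5 (R : realType) (s t v : nat) :
  ((1 <= s)%N -> (1 <= t)%N -> (1 <= v)%N ->
     sym_preserving_cost_Omega s t v (fun n p : nat =>
       ((n%:R ^+ (s + t + v) / p%:R : R) `^
          ((maxn (s + v) (maxn (v + t) (s + t)))%:R / (s + t + v)%:R))))
  /\
  (((s == 0) + (t == 0) + (v == 0) = 1)%N ->
     sym_preserving_cost_Omega s t v (fun n p : nat =>
       ((n%:R ^+ (s + t + v) / p%:R : R) `^
          ((maxn s (maxn t v))%:R / (s + t + v)%:R)))).
Proof.
split=> [s1 t1 v1|one0].
  have [-> //|[->|->]] : maxn (s + v) (maxn (v + t) (s + t)) = (s + v)%N \/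
    maxn (s + v) (maxn (v + t) (s + t)) = (v + t)%N \/
    maxn (s + v) (maxn (v + t) (s + t)) = (s + t)%N by lia.
  - exact: cost_Omega_A.
  - exact: cost_Omega_B.
  - exact: cost_Omega_C.
(* The largest parameter plus the zero one is the order of one of the tensors, and the remaining
   parameter is positive. *)
have [[t0 ->]|[[s0 ->]|[v0 ->]]] : ((0 < t)%N /\ maxn s (maxn t v) = (s + v)%N) \/
    ((0 < s)%N /\ maxn s (maxn t v) = (v + t)%N) \/
    ((0 < v)%N /\ maxn s (maxn t v) = (s + t)%N).
  by case: s t v one0 => [|s'] [|t'] [|v'] //= _; lia.
- exact: cost_Omega_A.
- exact: cost_Omega_B.
- exact: cost_Omega_C.
Qed.
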